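(* Suppose that $\mu<\infty$, where $\mu=\inf\{y:\mathbb{P}(X_e>y)=0\}$ is the essential supremum of the edge passage time $X_e$, and let $H(y)=\mathbb{P}(X_e>y)$. Then the following upper bounds for the variance of $W_n$ hold. (i) In the case when $\mathbb{P}(X_e=\mu)=p_0>0$, there exists some constant $D_1>0$ such that $$\operatorname{Var}(W_n)\le D_1\,n\ln n .$$ (ii) In the case when the tail probability function $H$ is left continuous at $\mu$, let $\bar x(n)$ be the unique solution $x$ of the equation $$\frac{\ln n}{n}=x\,H\!\left(\mu-\frac{x}{2}\right).$$ Then there exists some constant $D_2>0$ such that $$\operatorname{Var}(W_n)\le D_2\,\bar x(n)\,n^2 .$$ For example, if $H(y)=(\mu-y)^\alpha$ for large $y<\mu$ (that is, for $y<\mu$ close to $\mu$), where $\alpha>0$, then $$\operatorname{Var}(W_n)\le D_2\,\bar x(n)\,n^2\le 2^{\frac{\alpha}{\alpha+1}}D_2\,n^{2-\frac{1}{\alpha+1}}(\ln n)^{\frac{1}{\alpha+1}} .$$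
   Context: Last passage percolation on the complete graph. $G_n=([n],E_n)$ is the complete graph on $[n]=\{1,\dots,n\}$, with $E_n=\{\langle i,j\rangle:1\le i<j\le n\}$. Each edge $e\in E_n$ carries a random passage time $X_e$, and $\{X_e:e\in E_n\}$ are positive, independent and identically distributed random variables, with a law not depending on $n$. $\Pi_{1,n}$ is the set of all self-avoiding paths in $G_n$ between vertex $1$ and vertex $n$. The passage time of a path $\pi$ is $T(\pi)=\sum_{e\in\pi}X_e$, and $W_n=\sup_{\pi\in\Pi_{1,n}}T(\pi)$ is the largest passage time. The constant $\mu$ is also the time constant of the model, i.e. the almost sure limit of $W_n/n$ as $n\to\infty$. Left continuity of $H$ at $\mu$ means $\lim_{y\to\mu^-}H(y)=H(\mu)=0$. The constants $D_1,D_2$ do not depend on $n$.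
   Formalization: In (ii) the bound is for n ≥ 2 and any solution x of the equation (uniqueness proved; a solution may fail to exist if H jumps below μ); in the example the chain is asserted for all large n, since its second inequality can fail for small n. *)

(* Defs.v *)
From HB Require Import structures.
From mathcomp Require Import all_boot all_order all_algebra.
From mathcomp Require Import all_classical all_reals all_analysis.

Set Implicit Arguments.
Unset Strict Implicit.
Unset Printing Implicit Defensive.

Import Order.TTheory GRing.Theory Num.Theory.
Import numFieldNormedType.Exports.

Local Open Scope classical_set_scope.
Local Open Scope ring_scope.

(* The vertex set {1, ..., n} is represented by 'I_n, vertex k being the
   ordinal of value k - 1. *)
Notation edge n := {e : 'I_n * 'I_n | (e.1 < e.2)%N}.

(* A path is the sequence of its vertices: in a complete graph every
   duplicate-free sequence is a path. *)
Definition self_avoiding_paths (n : nat) : set (seq 'I_n) :=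
  [set p | exists (u : 'I_n) (q : seq 'I_n),
    [/\ p = u :: q, uniq (u :: q),
        nat_of_ord u = 0%N & nat_of_ord (last u q) = n.-1]].

Arguments self_avoiding_paths : clear implicits.

Definition path_edges (n : nat) (p : seq 'I_n) : {set edge n} :=
  [set e : edge n | ((val e).1, (val e).2) \in zip p (behead p)]
  :|: [set e : edge n | ((val e).2, (val e).1) \in zip p (behead p)].

Section last_passage.
Context (R : realType) (n : nat) (T : Type) (X : edge n -> T -> R).

Definition passage_time (p : seq 'I_n) (w : T) : R :=
  \sum_(e in path_edges p) X e w.

Definition largest_passage_time (w : T) : R :=
  sup [set passage_time p w | p in self_avoiding_paths n].

End last_passage.

Section random_families.
Context (R : realType) (d : measure_display) (T : measurableType d).
Context (P : probability T R).

Definition mutually_independent (I : finType) (X : I -> {RV P >-> R}) :=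
  forall (J : {set I}) (B : I -> set R), (forall i, measurable (B i)) ->
    P (\bigcap_(i in [set` J]) (X i @^-1` B i)) =
    (\prod_(i in J) P (X i @^-1` B i))%E.

(* Only measurable sets are tested: the values of measures on other sets are
   irrelevant. *)
Definition has_law (nu : probability R R) (X : {RV P >-> R}) :=
  forall B : set R, measurable B -> distribution P X B = nu B.

End random_families.

Section law.
Context (R : realType) (nu : probability R R).

Definition tail (y : R) : R := fine (nu `]y, +oo[%classic).

Definition law_ess_sup : \bar R :=
  ereal_inf [set y%:E | y in [set y : R | tail y = 0]].

Definition xbar_equation (mu : R) (n : nat) (x : R) :=
  ln n%:R / n%:R = x * tail (mu - x / 2).

End law.

(* Main.v *)
Require Import Defs.
From HB Require Import structures.
From mathcomp Require Import all_boot all_order all_algebra.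
From mathcomp Require Import all_classical all_reals all_analysis.
From mathcomp Require Import measurable_realfun ring lra.

(* All the bounds follow from the linear bound [Var(W_n) <= C n].  It is an
   instance of the Efron-Stein inequality: setting the passage time of one edge
   to 0 changes [W_n] by at most [M], and only when this edge lies on a fixed
   optimal path, which has [O(n)] edges.  The inequality is proved on a finite
   product space, reached by rounding the passage times down to a grid
   fine enough to move [W_n] by at most 1.  As [H <= 1], a solution [x] of the
   equation for [xbar] satisfies [x >= ln n / n], so that [n] is
   [O(n ln n) = O(x n^2)]. *)

Set Implicit Arguments.
Unset Strict Implicit.
Unset Printing Implicit Defensive.

Import Order.TTheory GRing.Theory Num.Theory.
Import numFieldNormedType.Exports.

Local Open Scope classical_set_scope.
Local Open Scope ring_scope.

(** * The Efron-Stein inequality on a finite product space *)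

Section efron_stein.
Context (R : realFieldType) (I A : finType) (q : I -> A -> R).
Hypothesis q_ge0 : forall i a, 0 <= q i a.
Hypothesis q_sum1 : forall i, \sum_a q i a = 1.

Definition update (f : {ffun I -> A}) (i : I) (a : A) : {ffun I -> A} :=
  [ffun j => if j == i then a else f j].

Definition average (i : I) (F : {ffun I -> A} -> R) (f : {ffun I -> A}) : R :=
  \sum_a q i a * F (update f i a).

(** For independent coordinates with laws [q i], this is the conditional expectation of [F] given
    the coordinates outside [s]. Writing it as an iterated sum makes induction on [s] available. *)
Definition averages (s : seq I) (F : {ffun I -> A} -> R) := foldr average F s.

Lemma update_update f i a b : update (update f i a) i b = update f i b.
Proof. by apply/ffunP => j; rewrite !ffunE; case: eqP. Qed.

Lemma updateC f i j a b : i != j ->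
  update (update f i a) j b = update (update f j b) i a.
Proof.
move=> ij; apply/ffunP => k; rewrite !ffunE.
by case: (eqVneq k j) => // ->; rewrite eq_sym (negbTE ij).
Qed.

(** Translation invariance of the variance. With [c] the mean, the last square vanishes and the
    variance is seen to be nonnegative; with [c] a value of [x], dropping that square bounds the
    variance by a mean square deviation. *)
Lemma weighted_varianceE (p x : A -> R) c : \sum_a p a = 1 ->
  \sum_a p a * x a ^+ 2 - (\sum_a p a * x a) ^+ 2 =
  \sum_a p a * (x a - c) ^+ 2 - (\sum_a p a * x a - c) ^+ 2.
Proof.
move=> p1; set m := \sum_a p a * x a.
have -> : \sum_a p a * (x a - c) ^+ 2 =
    \sum_a p a * x a ^+ 2 - 2 * c * m + c ^+ 2.
  have -> : c ^+ 2 = \sum_a p a * c ^+ 2 by rewrite -mulr_suml p1 mul1r.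
  rewrite /m !mulr_sumr -sumrB -big_split /=.
  by apply: eq_bigr => a _; ring.
ring.
Qed.

Lemma averages_le s (F G : {ffun I -> A} -> R) :
  (forall f, F f <= G f) -> forall f, averages s F f <= averages s G f.
Proof.
move=> FG; elim: s => //= i s IHs f; apply: ler_sum => a _.
by apply: ler_wpM2l.
Qed.

Lemma averages_sum s (J : Type) (r : seq J) (F : J -> {ffun I -> A} -> R) f :
  averages s (fun g => \sum_(j <- r) F j g) f = \sum_(j <- r) averages s (F j) f.
Proof.
elim: s f => //= i s IHs f; rewrite /average exchange_big; apply: eq_bigr => a _.
by rewrite IHs mulr_sumr.
Qed.

Lemma averages_cst s c f : averages s (fun=> c) f = c.
Proof.
elim: s f => //= i s IHs f; rewrite /average.
by under eq_bigr do rewrite IHs; rewrite -mulr_suml q_sum1 mul1r.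
Qed.

Lemma averages_sub s (F G : {ffun I -> A} -> R) f :
  averages s (fun g => F g - G g) f = averages s F f - averages s G f.
Proof.
elim: s f => //= i s IHs f; rewrite /average -sumrB; apply: eq_bigr => a _.
by rewrite IHs mulrBr.
Qed.

Lemma averages_update s i a F f : i \notin s ->
  averages s (fun g => F (update g i a)) f = averages s F (update f i a).
Proof.
elim: s f => //= j s IHs f; rewrite inE negb_or => /andP[ij /IHs is_].
by apply: eq_bigr => b _; rewrite is_ updateC // eq_sym.
Qed.

(** Jensen's inequality for the square, applied one coordinate at a time. *)
Lemma averages_sqr_le s F f :
  averages s F f ^+ 2 <= averages s (fun g => F g ^+ 2) f.
Proof.
elim: s f => //= i s IHs f; rewrite /average.
apply: (@le_trans _ _ (\sum_a q i a * averages s F (update f i a) ^+ 2)).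
  rewrite -subr_ge0.
  rewrite (weighted_varianceE _ (\sum_a q i a * averages s F (update f i a))) //.
  rewrite subrr expr0n subr0 sumr_ge0 // => a _.
  by rewrite mulr_ge0 // sqr_ge0.
by apply: ler_sum => a _; apply: ler_wpM2l.
Qed.

(* For [s = i :: s'], the variance splits into the mean over coordinate [i] of
   the variance over [s'] plus the variance over [i] of [averages s' F]; the
   latter is at most the mean square deviation from [averages s' F] at [a0],
   which Jensen's inequality moves inside [averages s']. *)
Lemma efron_stein_averages a0 s F f : uniq s ->
  averages s (fun g => F g ^+ 2) f - averages s F f ^+ 2 <=
  \sum_(i <- s) averages s (fun g => (F g - F (update g i a0)) ^+ 2) f.
Proof.
elim: s f => [|i s IHs] f; first by rewrite big_nil /= subrr.
move=> /= /andP[is_ us]; rewrite big_cons /= {1 2 3}/average.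
set G := averages s F; pose g a := update f i a.
have step : \sum_a q i a * averages s (fun g => F g ^+ 2) (g a) -
    \sum_a q i a * G (g a) ^+ 2 <=
    \sum_(j <- s) average i
      (averages s (fun g => (F g - F (update g j a0)) ^+ 2)) f.
  rewrite exchange_big -sumrB /=; apply: ler_sum => a _.
  by rewrite -mulrBr -mulr_sumr; apply: ler_wpM2l => //; exact: IHs.
have vari : \sum_a q i a * G (g a) ^+ 2 - (\sum_a q i a * G (g a)) ^+ 2 <=
    \sum_a q i a * averages s (fun g => (F g - F (update g i a0)) ^+ 2) (g a).
  rewrite (weighted_varianceE _ (G (g a0))) //.
  apply: (@le_trans _ _ (\sum_a q i a * (G (g a) - G (g a0)) ^+ 2)).
    by rewrite gerBl sqr_ge0.
  apply: ler_sum => a _; apply: ler_wpM2l => //.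
  apply: le_trans (averages_sqr_le _ _ _).
  by rewrite averages_sub averages_update // update_update.
rewrite /average -/G in step vari *; rewrite /g in step vari; lra.
Qed.

(** Coordinates outside [s] carry the Dirac weight at [f], so each induction step merely replaces
    one Dirac factor by [q i]. For [s] the full enumeration this is the expectation under the
    product law. *)
Lemma averages_prodE s F f : uniq s ->
  averages s F f =
  \sum_(g : {ffun I -> A})
    (\prod_i (if i \in s then q i (g i) else (g i == f i)%:R)) * F g.
Proof.
elim: s f => [|i s IHs] f /=.
  move=> _; rewrite (bigD1 f) //= big1 => [|i _]; last by rewrite eqxx.
  rewrite mul1r big1 ?addr0 // => g gf.
  have [i gfi] : exists i, g i != f i.
    apply/existsP; apply: contraNT gf; rewrite negb_exists => /forallP gf.
    by apply/eqP/ffunP => i; apply/eqP; move: (gf i); rewrite negbK.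
  by rewrite (bigD1 i) //= (negbTE gfi) !mul0r.
move=> /andP[is_ us]; rewrite -/(averages s F) /average.
under [LHS]eq_bigr do rewrite IHs // mulr_sumr.
rewrite exchange_big /=; apply: eq_bigr => g _.
under [LHS]eq_bigr do rewrite mulrA.
rewrite -mulr_suml; congr (_ * _).
(* On the left the factor at [i] is the indicator of [g i == a], so only the term [a = g i]
   survives. *)
rewrite [RHS](bigD1 i) //= mem_head (bigD1 (g i)) //= [X in _ + X]big1 ?addr0.
  rewrite (bigD1 i) //= (negbTE is_) ffunE !eqxx mul1r; congr (_ * _).
  by apply: eq_bigr => j ji; rewrite inE (negbTE ji) ffunE (negbTE ji).
move=> a agi; rewrite (bigD1 i) //= (negbTE is_) ffunE eqxx eq_sym.
by rewrite (negbTE agi) mul0r mulr0.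
Qed.

Lemma sum_prod_weights : \sum_(g : {ffun I -> A}) \prod_i q i (g i) = 1.
Proof. by rewrite -bigA_distr_bigA big1. Qed.

(** The independent copy of the classical inequality is replaced by a reset to [a0]: a conditional
    variance is at most the mean square distance to any value that does not depend on the coordinate
    concerned. *)
Lemma efron_stein a0 (F : {ffun I -> A} -> R) (V : R) :
  (forall f, \sum_i (F f - F (update f i a0)) ^+ 2 <= V) ->
  exists c, \sum_(g : {ffun I -> A}) (\prod_i q i (g i)) * (F g - c) ^+ 2 <= V.
Proof.
(* The base point is immaterial, since every coordinate gets averaged; the witness [c] is the mean
   of [F]. *)
move=> FV; pose f0 : {ffun I -> A} := [ffun=> a0].
have Eprod G : averages (enum I) G f0 =
    \sum_(g : {ffun I -> A}) (\prod_i q i (g i)) * G g.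
  rewrite averages_prodE ?enum_uniq //; apply: eq_bigr => g _.
  by congr (_ * _); apply: eq_bigr => i _; rewrite mem_enum.
pose c := averages (enum I) F f0; exists c.
apply: (@le_trans _ _ (averages (enum I) (fun g => F g ^+ 2) f0 - c ^+ 2)).
  rewrite Eprod [leLHS](_ : _ =
    \sum_(g : {ffun I -> A}) (\prod_i q i (g i)) * F g ^+ 2
    - 2 * c * (\sum_(g : {ffun I -> A}) (\prod_i q i (g i)) * F g) +
    c ^+ 2 * \sum_(g : {ffun I -> A}) \prod_i q i (g i)).
    rewrite sum_prod_weights -(Eprod F) -/c; lra.
  rewrite !mulr_sumr -sumrB -big_split /=; apply: eq_bigr => g _; ring.
apply: (le_trans (efron_stein_averages a0 F f0 (enum_uniq I))).
rewrite -averages_sum -[leRHS](averages_cst (enum I) _ f0).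
apply: averages_le => f; rewrite big_enum /=; exact: FV.
Qed.

End efron_stein.

(** * Variance of a function close to a function of finitely many cells *)

Section discretised_variance.
Context (R : realType) (d : measure_display) (T : measurableType d).
Context (P : probability T R).

Lemma ae_bounded_Lfun2 (W : T -> R) (K : R) : measurable_fun setT W ->
  {ae P, forall w, `|W w| <= K} -> W \in Lfun P 2%:E.
Proof.
move=> mW WK; rewrite inE; apply/andP; split; rewrite inE //=.
rewrite /finite_norm unlock /Lnorm poweR_lty//.
apply: (@le_lt_trans _ _ (\int[P]_x (cst ((`|K| `^ 2)%:E) x))%E); last first.
  by rewrite integral_cst//= probability_setT mule1 ltry.
apply: ae_ge0_le_integral => //=.
- apply/measurable_EFinP.
  apply: (@measurableT_comp _ _ _ _ _ _ (fun x : R => x `^ 2)%R) => //.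
  exact/measurableT_comp.
apply: filterS WK => w WK _; rewrite lee_fin.
apply: ge0_ler_powR => //; rewrite ?nnegrE//.
exact: le_trans WK (ler_norm _).
Qed.

(** Shifting by [c] leaves the variance unchanged, and then the squared mean of [W - c] is dropped.
    The almost sure bound provides square integrability. *)
Lemma variance_le_sqr_dist (W : T -> R) (K c : R) : measurable_fun setT W ->
  {ae P, forall w, `|W w| <= K} ->
  ('V_P[W] <= \int[P]_w ((W w - c) ^+ 2)%:E)%E.
Proof.
move=> mW WK; have W2 := ae_bounded_Lfun2 mW WK.
have Wc2 : (W \- cst c)%R \in Lfun P 2%:E.
  apply: (@ae_bounded_Lfun2 _ (K + `|c|)); first exact: measurable_funB.
  by apply: filterS WK => w WK; rewrite (le_trans (ler_normB _ _))// lerD.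
rewrite -(varianceB_cst_r c W2) varianceE//.
rewrite [X in (X - _)%E](_ : _ = \int[P]_w ((W w - c) ^+ 2)%:E)%E; last first.
  by rewrite unlock; apply: eq_integral => w _.
rewrite leeBlDr ?leeDl//.
  exact: sqre_ge0.
rewrite fin_numX// expectation_fin_num//.
by apply: Lfun_subset12; first by rewrite fin_num_measure.
Qed.

Context (I A : finType) (X : I -> {RV P >-> R}) (B : A -> set R).
Hypothesis X_indep : mutually_independent X.
Hypothesis mB : forall a, measurable (B a).
Hypothesis tB : trivIset setT B.
Hypothesis X_B : forall i, {ae P, forall w, exists a, B a (X i w)}.

Let q i a : R := fine (P (X i @^-1` B a)).

Let mXB i a : measurable (X i @^-1` B a).
Proof. by rewrite -[X in measurable X]setTI; exact: measurable_funP. Qed.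

Let q_sum1 i : \sum_a q i a = 1.
Proof.
apply: EFin_inj; rewrite -sumEFin.
under eq_bigr do rewrite fineK ?fin_num_measure//.
have tXB : trivIset setT (fun a => X i @^-1` B a).
  apply/trivIsetP => a b _ _ ab; rewrite -preimage_setI.
  by move/trivIsetP : tB => -> //; rewrite preimage_set0.
pose C := \bigcup_a (X i @^-1` B a).
have mC : measurable C by apply: fin_bigcup_measurable => //; exact: finite_finset.
have <- : P C = (\sum_a P (X i @^-1` B a))%E.
  rewrite (fsbig_seq _ _ (index_enum_uniq A)) measure_fin_bigcup//; last first.
    exact: finite_finset.
  by congr (\sum_(a \in _) _)%E; apply/seteqP; split => a _ //=; rewrite mem_index_enum.
rewrite -[C]setCK probability_setC; last exact: measurableC.
rewrite measure_negligible ?sube0//; first exact: measurableC.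
apply: negligibleS (X_B i) => w /= Cw [a Ba]; apply: Cw; by exists a.
Qed.

Let cell (f : {ffun I -> A}) : set T := \bigcap_i (X i @^-1` B (f i)).

Let mcell f : measurable (cell f).
Proof. exact: fin_bigcap_measurable. Qed.

(** Independence enters here: it gives the cells the product weights that [efron_stein] works
    with. *)
Let P_cell f : P (cell f) = (\prod_i q i (f i))%:E.
Proof.
have := X_indep [set: I]%SET (fun i => mB (f i)).
rewrite [X in P X = _ -> _](_ : _ = cell f); last first.
  by apply: eq_bigcapl; split => i _ /=; rewrite ?inE.
move=> ->; rewrite -prodEFin; apply: eq_big => [i|i _]; first by rewrite inE.
by rewrite fineK ?fin_num_measure.
Qed.

(** Take [c] from [efron_stein] applied to [F]. Since [W] is within [eps] of [F], the mean square
    distance of [W] to [c] is at most twice that of [F] plus [2 eps^2]. *)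
Lemma variance_le_discrete (W : T -> R) (F : {ffun I -> A} -> R) (a0 : A)
    (V eps : R) : measurable_fun setT W ->
  (forall f, \sum_i (F f - F (update f i a0)) ^+ 2 <= V) ->
  {ae P, forall w, forall f : {ffun I -> A}, (forall i, B (f i) (X i w)) ->
    `|W w - F f| <= eps} ->
  ('V_P[W] <= (2 * V + 2 * eps ^+ 2)%:E)%E.
Proof.
move=> mW FV WF.
have WFf : {ae P, forall w, exists2 f, cell f w & `|W w - F f| <= eps}.
  have : {ae P, forall w, forall i, exists a, B a (X i w)}.
    exact: filter_forall.
  apply: filterS2 WF => w WF /choice[g Bg].
  exists [ffun i => g i]; last by apply: WF => i; rewrite ffunE.
  by move=> i _ /=; rewrite ffunE.
have q_ge0 i a : 0 <= q i a by exact: fine_ge0.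
have [c Fc] := efron_stein q_ge0 q_sum1 FV.
have W_bounded : {ae P, forall w, `|W w| <= \sum_f `|F f| + eps}.
  apply: filterS WFf => w [f _ WFf].
  rewrite -[W w](subrK (F f)) addrC (le_trans (ler_normD _ _))// lerD//.
  by rewrite (bigD1 f)//= lerDl sumr_ge0.
apply: le_trans (variance_le_sqr_dist c mW W_bounded) _.
(* On the cell of [f], [k f] dominates [(W - c)^2], because [(x + y)^2 <= 2 x^2 + 2 y^2] with
   [x = W - F f] and [y = F f - c]. The integral is then compared with that of a step function. *)
pose k f := 2 * (F f - c) ^+ 2 + 2 * eps ^+ 2.
have k_ge0 f : 0 <= k f by rewrite addr_ge0// mulr_ge0// sqr_ge0.
have mk f : measurable_fun setT (fun w => ((k f)%:E * (\1_(cell f) w)%:E)%E).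
  apply/measurable_EFinP; apply: measurable_funM => //.
apply: (@le_trans _ _ (\int[P]_w \sum_f ((k f)%:E * (\1_(cell f) w)%:E))%E).
  apply: ae_ge0_le_integral => //=.
  - by move=> w _; rewrite lee_fin sqr_ge0.
  - apply/measurable_EFinP; apply: measurable_funX.
    exact: measurable_funB.
  - by move=> w _; apply: sume_ge0 => f _; rewrite -EFinM lee_fin mulr_ge0.
  - exact: emeasurable_sum.
  apply: filterS WFf => w [f fw WFf] _.
  rewrite (bigD1 f)//= indicE mem_set// mule1.
  apply: (@le_trans _ _ (k f)%:E); last first.
    by rewrite leeDl//; apply: sume_ge0 => g _; rewrite -EFinM lee_fin mulr_ge0.
  rewrite lee_fin /k; move: WFf; rewrite ler_norml => /andP[].
  set x := W w - F f; have -> : W w - c = x + (F f - c) by rewrite /x; ring.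
  set y := F f - c; move=> xge xle; have xy_ge0 := sqr_ge0 (x - y).
  have : 0 <= (eps - x) * (eps + x) by apply: mulr_ge0; lra.
  nra.
rewrite ge0_integral_sum//; last first.
  by move=> f w _; rewrite -EFinM lee_fin mulr_ge0.
have int_cell f : (\int[P]_w ((k f)%:E * (\1_(cell f) w)%:E) =
    (k f * \prod_i q i (f i))%:E)%E.
  rewrite ge0_integralZl_EFin//; last exact/measurable_EFinP.
  by rewrite integral_indic// setIT EFinM -P_cell.
under eq_bigr do rewrite int_cell.
rewrite sumEFin lee_fin.
under eq_bigr do rewrite /k mulrC mulrDr mulrCA.
rewrite big_split /= -mulr_suml -mulr_sumr sum_prod_weights//.
by rewrite mul1r lerD2r ler_pM2l.
Qed.
End discretised_variance.

(** * Maximal weight over a family of subsets of a finite set *)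

Section max_weight.
Context (R : realType) (I : finType) (S : set {set I}).
Hypothesis S_neq0 : S !=set0.

Definition max_weight (x : I -> R) : R := sup [set \sum_(i in E) x i | E in S].

(** A finite nonempty family attains its supremum; the later arguments all work with such a
    maximiser. *)
Lemma max_weightP (x : I -> R) : exists E, [/\ S E,
  max_weight x = \sum_(i in E) x i &
  forall E', S E' -> \sum_(i in E') x i <= \sum_(i in E) x i].
Proof.
have [E0 SE0] := S_neq0; have S0 : (fun E => `[< S E >]) E0 by apply/asboolP.
have [E /asboolP SE maxE] :=
  @arg_maxP _ R _ E0 (fun E => `[< S E >]) (fun E => \sum_(i in E) x i) S0.
have maxE' E' : S E' -> \sum_(i in E') x i <= \sum_(i in E) x i.
  by move=> SE'; apply: maxE; apply/asboolP.
exists E; split=> //; apply/eqP; rewrite eq_le; apply/andP; split.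
  apply: ge_sup; first by exists (\sum_(i in E0) x i), E0.
  by move=> _ [E' SE' <-]; exact: maxE'.
apply: ub_le_sup; last by exists E.
by exists (\sum_(i in E) x i) => _ [E' SE' <-]; exact: maxE'.
Qed.

Lemma le_max_weight (x : I -> R) E : S E -> \sum_(i in E) x i <= max_weight x.
Proof. by have [E' [_ -> maxE']] := max_weightP x; exact: maxE'. Qed.

Context (k : nat).
Hypothesis S_card : forall E, S E -> (#|E| <= k)%N.

(** A maximiser for one weighting competes for the other, and its sum has at most [k] terms, each
    moving by at most [e]. *)
Lemma max_weight_lipschitz (x y : I -> R) (e : R) : 0 <= e ->
  (forall i, `|x i - y i| <= e) -> `|max_weight x - max_weight y| <= k%:R * e.
Proof.
move=> e_ge0.
suff half u v : (forall i, `|u i - v i| <= e) ->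
    max_weight u <= max_weight v + k%:R * e.
  move=> xy; have yx i : `|y i - x i| <= e by rewrite distrC.
  by have := half _ _ xy; have := half _ _ yx; rewrite ler_norml; lra.
move=> uv; have [E [SE -> _]] := max_weightP u.
apply: le_trans (lerD (le_max_weight v SE) (lexx _)).
rewrite -lerBlDl -sumrB (@le_trans _ _ (\sum_(i in E) e))//.
  by apply: ler_sum => i _; exact: le_trans (ler_norm _) (uv i).
by rewrite sumr_const -[_ *+ _]mulr_natl ler_wpM2r// ler_nat S_card.
Qed.

(* Deleting the weight of [i] only affects the maximum when [i] belongs to a
   fixed maximiser, so at most [k] of the differences are nonzero. *)
Lemma max_weight_bounded_differences (x : I -> R) (M : R) :
  (forall i, 0 <= x i <= M) ->
  \sum_i (max_weight x - max_weight (fun j => if j == i then 0 else x j)) ^+ 2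
  <= k%:R * M ^+ 2.
Proof.
move=> xM; have [E [SE maxE _]] := max_weightP x.
pose x' i j := if j == i then 0 else x j.
have x'_le i : max_weight (x' i) <= max_weight x.
  have [E' [SE' -> _]] := max_weightP (x' i).
  apply: le_trans (le_max_weight x SE'); apply: ler_sum => j _.
  by rewrite /x'; case: eqP => // _; have /andP[] := xM j.
have x'_ge i : max_weight x - max_weight (x' i) <= if i \in E then M else 0.
  rewrite maxE lerBlDr -lerBlDl.
  apply: le_trans (le_max_weight (x' i) SE); rewrite lerBlDr -lerBlDl -sumrB.
  case: ifPn => iE.
    rewrite (bigD1 i)//= big1 ?addr0; last first.
      by move=> j /andP[_ /negbTE ji]; rewrite /x' ji subrr.
    by rewrite /x' eqxx subr0; have /andP[] := xM i.
  rewrite big1// => j jE; rewrite /x' ifN ?subrr//.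
  by apply: contraNneq iE => <-.
apply: (@le_trans _ _ (\sum_(i in E) M ^+ 2)).
  rewrite [leRHS]big_mkcond; apply: ler_sum => i _.
  have := x'_ge i; have := x'_le i; case: ifP => _; rewrite /x' => ? ?.
    by rewrite ler_sqr ?nnegrE ?subr_ge0//; lra.
  by rewrite (_ : _ - _ = 0) ?expr0n//; lra.
by rewrite sumr_const -[_ *+ _]mulr_natl ler_wpM2r ?sqr_ge0// ler_nat S_card.
Qed.

Context (d : measure_display) (T : measurableType d) (P : probability T R).
Context (X : I -> {RV P >-> R}).

(** The maximum exceeds [a] exactly when one of finitely many sums does. *)
Lemma measurable_max_weight :
  measurable_fun setT (fun w => max_weight (fun i => X i w)).
Proof.
move=> mT; apply: (measurability _ (RGenOInfty.measurableE R)) => //.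
move=> _ [_ [a ->] <-]; rewrite setTI.
rewrite [X in measurable X](_ : _ =
    \bigcup_(E in S) ((fun w => \sum_(i in E) X i w) @^-1` `]a, +oo[)).
  apply: fin_bigcup_measurable => [|E _]; first exact: finite_finset.
  have mE : measurable_fun setT (fun w => \sum_(i in E) X i w).
    under eq_fun do rewrite -big_enum; apply: measurable_sum => i.
    exact: measurable_funP.
  by rewrite -[X in measurable X]setTI; exact: mE.
apply/seteqP; split => w /=; rewrite ?in_itv/= ?andbT.
  have [E [SE -> _]] := max_weightP (fun i => X i w) => aE.
  by exists E => //=; rewrite in_itv/= andbT.
move=> [E SE]; rewrite /= in_itv/= andbT => aE.
exact: lt_le_trans aE (le_max_weight (fun i => X i w) SE).
Qed.

Hypothesis X_indep : mutually_independent X.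

Lemma variance_max_weight_le (M : R) : 0 <= M ->
  (forall i, {ae P, forall w, 0 <= X i w <= M}) ->
  ('V_P[fun w => max_weight (fun i => X i w)] <=
   (2 * k%:R * M ^+ 2 + 2)%:E)%E.
Proof.
(* The mesh [1 / m] with [m = k + 1] makes the total rounding error [k / m] at most 1, and stays
   meaningful for [k = 0]. *)
move=> M_ge0 XM; pose m : R := k.+1%:R.
have m_gt0 : 0 < m by rewrite ltr0n.
(* [K] is the index of the last grid cell that meets [[0, M]], whence [K.+1] cells; [v j] is the
   left endpoint of cell [j]. *)
pose K := Num.truncn (m * M).
pose B (j : 'I_K.+1) : set R := `[j%:R / m, j.+1%:R / m[%classic.
pose v (j : 'I_K.+1) : R := j%:R / m.
have BP j x : B j x <-> j%:R <= m * x < j.+1%:R.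
  by rewrite /B /= in_itv/= ler_pdivrMr// ltr_pdivlMr// (mulrC x).
have tB : trivIset setT B.
  move=> i j _ _ [x [/BP /Num.Theory.truncn_def xi /BP /Num.Theory.truncn_def xj]].
  by apply: val_inj; rewrite /= -xi -xj.
have v_itv j : 0 <= v j <= M.
  rewrite /v divr_ge0 ?(ltW m_gt0)//= ler_pdivrMr// (mulrC M).
  have /andP[] := Num.Theory.truncn_itv (mulr_ge0 (ltW m_gt0) M_ge0).
  move=> + _; apply: le_trans; rewrite ler_nat -ltnS; exact: ltn_ord.
have X_B i : {ae P, forall w, exists j, B j (X i w)}.
  apply: filterS (XM i) => w /andP[X_ge0 X_le].
  have ltK : (Num.truncn (m * X i w) < K.+1)%N.
    by rewrite ltnS Num.Theory.le_truncn// ler_pM2l.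
  exists (Ordinal ltK); apply/BP.
  by rewrite Num.Theory.truncn_itv// mulr_ge0// (ltW m_gt0).
pose F (f : {ffun I -> 'I_K.+1}) := max_weight (fun i => v (f i)).
have FV f : \sum_i (F f - F (update f i ord0)) ^+ 2 <= k%:R * M ^+ 2.
  (* As [v ord0 = 0], resetting a coordinate to [ord0] is the same as deleting its weight. *)
  apply: le_trans (max_weight_bounded_differences (fun i => v_itv (f i))).
  apply: ler_sum => i _; rewrite le_eqVlt; apply/orP; left; apply/eqP.
  congr ((_ - max_weight _) ^+ 2); apply/funext => j; rewrite ffunE.
  by case: eqP => // _; rewrite /v mul0r.
have WF : {ae P, forall w, forall f : {ffun I -> 'I_K.+1},
    (forall i, B (f i) (X i w)) ->
    `|max_weight (fun i => X i w) - F f| <= 1}.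
  apply: nearW => w f BX.
  apply: (@le_trans _ _ (k%:R * m^-1)); last first.
    by rewrite ler_pdivrMr// mul1r ler_nat.
  apply: max_weight_lipschitz => [|i]; first by rewrite invr_ge0 ltW.
  have := BX i; rewrite /B /= in_itv/= -natr1 mulrDl mul1r /v => /andP[Xge Xlt].
  by rewrite ger0_norm ?subr_ge0// lerBlDl ltW.
have mB j : measurable (B j) by exact: measurable_itv.
have := variance_le_discrete X_indep mB tB X_B measurable_max_weight FV WF.
by rewrite expr1n mulr1 mulrA.
Qed.

End max_weight.

(** * Self-avoiding paths in the complete graph *)

(** A duplicate-free path has at most [n] consecutive pairs. The two orientations are counted
    separately, which accounts for the factor 2; only linearity in [n] matters later. *)
Lemma card_path_edges n (p : seq 'I_n) : uniq p -> (#|path_edges p| <= 2 * n)%N.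
Proof.
move=> up; have size_p : (size p <= n)%N.
  by rewrite -(card_uniqP up) -[leqRHS]card_ord max_card.
have half (h : edge n -> 'I_n * 'I_n) : injective h ->
    (#|[set e | h e \in zip p (behead p)]%SET| <= n)%N.
  move=> inj_h; apply: leq_trans size_p.
  apply: (@leq_trans (size (zip p (behead p)))); last first.
    by rewrite size_zip geq_minl.
  rewrite cardE -(size_map h); apply: uniq_leq_size.
    by rewrite map_inj_uniq// enum_uniq.
  by move=> _ /mapP[e + ->]; rewrite mem_enum inE.
rewrite mul2n -addnn; apply: leq_trans (leq_card_setU _ _) (leq_add _ _).
  by apply: half => -[[a b] ab] [[a' b'] ab'] /= [*]; apply: val_inj; congr pair.
by apply: half => -[[a b] ab] [[a' b'] ab'] /= [*]; apply: val_inj; congr pair.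
Qed.

Lemma self_avoiding_paths_neq0 n : (0 < n)%N -> self_avoiding_paths n !=set0.
Proof.
case: n => // -[_|n _].
  by exists [:: ord0], ord0, [::].
by exists [:: ord0; ord_max], ord0, [:: ord_max].
Qed.

Lemma largest_passage_timeE (R : realType) n (T : Type) (X : edge n -> T -> R) w :
  largest_passage_time X w =
  max_weight (@path_edges n @` self_avoiding_paths n) (fun e => X e w).
Proof. by rewrite /largest_passage_time /max_weight image_comp. Qed.

(** The case [n = 1] must be exact: [ln 1 = 0] makes the variance bound vanish there. *)
Lemma largest_passage_time_1 (R : realType) (T : Type) (X : edge 1 -> T -> R) :
  largest_passage_time X = cst 0.
Proof.
apply/funext => w; rewrite /largest_passage_time.
rewrite [X in sup X](_ : _ = [set 0]) ?sup1//.
have time0 p : passage_time X p w = 0.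
  by rewrite /passage_time big1// => -[[i j] /= ij]; move: ij; rewrite !ord1.
apply/seteqP; split => [_ [p _ <-]//|_ ->].
by have [p Sp] := @self_avoiding_paths_neq0 1 isT; exists p.
Qed.

(** * The tail function and the equation for [xbar] *)

Lemma tail_le1 (R : realType) (nu : probability R R) y : tail nu y <= 1.
Proof.
rewrite /tail -lee_fin fineK ?fin_num_measure//; exact: probability_le1.
Qed.

Lemma tail_ge0 (R : realType) (nu : probability R R) y : 0 <= tail nu y.
Proof. exact: fine_ge0. Qed.

Lemma le_tail (R : realType) (nu : probability R R) x y :
  x <= y -> tail nu y <= tail nu x.
Proof.
move=> xy; rewrite fine_le ?fin_num_measure// le_measure ?inE//.
by apply: subset_itvr; rewrite bnd_simp.
Qed.

(** For [n > 1] the left side is positive, so at a solution both [x] and the tail are positive. The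
    tail at [mu - x / 2] is nondecreasing in [x], so the right side is strictly larger at the larger
    of two distinct solutions. *)
Lemma xbar_equation_unique (R : realType) (nu : probability R R) mu n x :
  (1 < n)%N -> xbar_equation nu mu n x -> unique (xbar_equation nu mu n) x.
Proof.
move=> n1; have rhs_gt0 : 0 < ln n%:R / n%:R :> R.
  by rewrite divr_gt0 ?ln_gt0 ?ltr1n ?ltr0n// ltnW.
have pos z : xbar_equation nu mu n z -> 0 < z /\ 0 < tail nu (mu - z / 2).
  rewrite /xbar_equation => ez; move: rhs_gt0; rewrite ez.
  have := tail_ge0 nu (mu - z / 2); rewrite le_eqVlt => /predU1P[<-|H0].
    by rewrite mulr0 ltxx.
  by rewrite pmulr_lgt0.
have incr y z : xbar_equation nu mu n y -> xbar_equation nu mu n z -> ~ y < z.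
  move=> ey ez yz; have [y0 Hy0] := pos _ ey; have [z0 Hz0] := pos _ ez.
  have : y * tail nu (mu - y / 2) < z * tail nu (mu - z / 2).
    apply: (@lt_le_trans _ _ (z * tail nu (mu - y / 2))); first by rewrite ltr_pM2r.
    by rewrite ler_pM2l// le_tail// lerD2l lerN2 ler_pM2r// ltW.
  by rewrite -ey -ez ltxx.
move=> ex; split=> // z ez; apply/eqP; rewrite eq_le !leNgt.
by apply/andP; split; apply/negP; exact: incr.
Qed.

Lemma xbar_equation_ge (R : realType) (nu : probability R R) mu n x :
  (1 < n)%N -> xbar_equation nu mu n x -> ln n%:R / n%:R <= x.
Proof.
move=> n1 ex; have rhs_gt0 : 0 < ln n%:R / n%:R :> R.
  by rewrite divr_gt0 ?ln_gt0 ?ltr1n ?ltr0n// ltnW.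
have x_ge0 : 0 <= x.
  rewrite leNgt; apply/negP => x_lt0; move: rhs_gt0; rewrite ex ltNge.
  by rewrite mulr_le0_ge0 ?tail_ge0// ltW.
by rewrite ex ler_piMr// tail_le1.
Qed.

(** From [ln n = 2 ln (sqrt n) < 2 sqrt n], the quotient is below [2 / sqrt n], hence below [c] once
    [n > 4 / c^2]. *)
Lemma near_ln_div_lt (R : realType) (c : R) : 0 < c ->
  \forall n \near \oo, ln n%:R / n%:R < c.
Proof.
move=> c0; near=> n.
have n_gt0 : 0 < n%:R :> R by rewrite ltr0n; near: n; exact: nbhs_infty_gt.
have n_gt : 4 / c ^+ 2 < n%:R by near: n; exact: nbhs_infty_gtr.
set s := Num.sqrt (n%:R : R); have s_gt0 : 0 < s by rewrite sqrtr_gt0.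
have sE : n%:R = s ^+ 2 by rewrite sqr_sqrtr// ltW.
rewrite ltr_pdivrMr// sE lnXn//.
have := ln_sublinear s_gt0 => lns.
have : 2 < c * s.
  rewrite -ltr_sqr ?nnegrE ?mulr_ge0 ?ltW// exprMn -sE mulrC.
  by rewrite -ltr_pdivrMr ?exprn_gt0//; move: n_gt; rewrite -natrX.
move=> cs; apply: (@lt_trans _ _ (s *+ 2)); first by rewrite ltrMn2r.
by rewrite expr2 mulrA -mulr_natl ltr_pM2r.
Unshelve. all: by end_near. Qed.

(** Under the power law the equation reads [x^(alpha + 1) = 2^alpha * ln n / n], which is solved
    explicitly. *)
Lemma xbar_equation_powR (R : realType) (nu : probability R R) mu alpha n x :
  0 < alpha -> (1 < n)%N ->
  x = (2 `^ alpha * (ln n%:R / n%:R)) `^ (alpha + 1)^-1 ->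
  tail nu (mu - x / 2) = (x / 2) `^ alpha ->
  xbar_equation nu mu n x.
Proof.
move=> alpha0 n1 xE Hx; rewrite /xbar_equation Hx.
have rhs_ge0 : 0 <= ln n%:R / n%:R :> R.
  by rewrite divr_ge0 ?ln_ge0 ?ler1n// ltnW.
have x_ge0 : 0 <= x by rewrite xE powR_ge0.
have : x * x `^ alpha = 2 `^ alpha * (ln n%:R / n%:R).
  have -> : x `^ alpha = x `^ ((alpha + 1) - 1) by rewrite addrK.
  rewrite mulr_powRB1 ?addr_gt0// xE -powRrM mulVf ?gt_eqF ?addr_gt0//.
  by rewrite powRr1// mulr_ge0 ?powR_ge0.
have -> : x `^ alpha = (x / 2) `^ alpha * 2 `^ alpha.
  by rewrite -powRM ?divr_ge0// divfK.
by rewrite mulrA mulrC => /mulfI -> //; rewrite gt_eqF// powR_gt0.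
Qed.

(** * Variance bounds for the largest passage time *)

Lemma variance_largest_passage_time_le (R : realType) (d : measure_display)
    (T : measurableType d) (P : probability T R) (nu : probability R R)
    (X : forall n : nat, edge n -> {RV P >-> R}) (mu : R) :
  (forall n (e : edge n), {ae P, forall w, 0 < X n e w}) ->
  (forall n, mutually_independent (X n)) ->
  (forall n (e : edge n), has_law nu (X n e)) ->
  law_ess_sup nu = mu%:E ->
  exists2 D : R, 0 < D & forall n, (0 < n)%N ->
    ('V_P[largest_passage_time (X n)] <= (D * n%:R * ln n%:R)%:E)%E.
Proof.
move=> X_pos X_indep X_law mu_def.
(* The infimum of the empty set is [+oo], so a finite essential supremum yields a point [y] of zero
   tail, which bounds the passage times almost surely. *)
have [y Hy0] : exists y, tail nu y = 0.
  apply: contrapT => /forallNP noy; move: mu_def; rewrite /law_ess_sup.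
  rewrite [X in ereal_inf X](_ : _ = set0) ?ereal_inf0//.
  by apply/seteqP; split => // t [z /= /noy].
pose M := `|y|; have XM n (e : edge n) : {ae P, forall w, 0 <= X n e w <= M}.
  have X_le : {ae P, forall w, X n e w <= y}.
    exists (X n e @^-1` `]y, +oo[); split.
    - by rewrite -[X in measurable X]setTI; exact: measurable_funP.
    - have := X_law n e `]y, +oo[%classic (measurable_itv _).
      rewrite /distribution /pushforward /= => ->.
      by rewrite -[LHS]fineK ?fin_num_measure//; congr (_%:E).
    - by move=> w /= /negP; rewrite -ltNge in_itv/= andbT.
  apply: filterS2 (X_pos n e) X_le => w X0 Xy.
  by rewrite ltW//= (le_trans Xy)// ler_norm.
(* With [k = 2 n], the bound [2 k M^2 + 2] is [4 n M^2 + 2 <= C n]. For [n >= 2], [ln n >= ln 2]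
   then gives the constant [C / ln 2]. *)
pose C := 4 * M ^+ 2 + 2; have C_gt0 : 0 < C.
  by rewrite ltr_wpDl// mulr_ge0// sqr_ge0.
have ln2_gt0 : 0 < ln 2 :> R by rewrite ln_gt0// ltr1n.
exists (C / ln 2) => [|n]; first exact: divr_gt0.
case: n => [//|[_|n _]].
  by rewrite largest_passage_time_1 variance_cst ln1 mulr0.
set N := n.+2; have N0 : (0 < N)%N by [].
have S_neq0 : @path_edges N @` self_avoiding_paths N !=set0.
  by have [p Sp] := self_avoiding_paths_neq0 N0; exists (path_edges p), p.
have S_card E : (@path_edges N @` self_avoiding_paths N) E -> (#|E| <= 2 * N)%N.
  by move=> [p [u [q [-> uq _ _]]] <-]; exact: card_path_edges.
rewrite (_ : largest_passage_time _ = fun w => max_weight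
  (@path_edges N @` self_avoiding_paths N) (fun e => X N e w)); last first.
  by apply/funext => w; exact: largest_passage_timeE.
apply: le_trans (variance_max_weight_le S_neq0 S_card (X_indep N) _ (@XM N)) _.
  exact: normr_ge0.
rewrite lee_fin; apply: (@le_trans _ _ (C * N%:R)).
  rewrite natrM /C; have : 1 <= N%:R :> R by rewrite ler1n.
  lra.
rewrite -!mulrA ler_pM2l// mulrCA ler_peMr ?ler0n//.
by rewrite mulrC ler_pdivlMr// mul1r ler_ln ?posrE ?ltr0n// ler_nat.
Qed.

Theorem corollary1p5 (R : realType) (d : measure_display)
    (T : measurableType d) (P : probability T R) (nu : probability R R)
    (X : forall n : nat, edge n -> {RV P >-> R})
    (X_pos : forall (n : nat) (e : edge n), {ae P, forall w, 0 < X n e w})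
    (X_indep : forall n : nat, mutually_independent (X n))
    (X_law : forall (n : nat) (e : edge n), has_law nu (X n e))
    (mu : R) (mu_def : law_ess_sup nu = mu%:E) :
  let H := tail nu in
  let W (n : nat) := largest_passage_time (X n) in
  (forall p0 : R, 0 < p0 -> nu [set mu] = p0%:E ->
     exists2 D1 : R, 0 < D1 &
       forall n : nat, (0 < n)%N ->
         ('V_P[W n] <= (D1 * n%:R * ln n%:R)%:E)%E)
  /\
  (H y @[y --> mu^'-] --> H mu ->
     exists2 D2 : R, 0 < D2 &
       (forall (n : nat) (x : R), (1 < n)%N -> xbar_equation nu mu n x ->
          unique (xbar_equation nu mu n) x /\
          ('V_P[W n] <= (D2 * x * n%:R ^+ 2)%:E)%E)
       /\
       (forall alpha : R, 0 < alpha ->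
          (\forall y \near mu^'-, H y = (mu - y) `^ alpha) ->
          \forall n \near \oo, exists x : R,
            [/\ unique (xbar_equation nu mu n) x,
                ('V_P[W n] <= (D2 * x * n%:R ^+ 2)%:E)%E &
                D2 * x * n%:R ^+ 2 <=
                  2 `^ (alpha / (alpha + 1)) * D2
                  * n%:R `^ (2 - (alpha + 1)^-1)
                  * (ln n%:R) `^ ((alpha + 1)^-1)])).
Proof.
move=> H W.
have [D D_gt0 VW] := variance_largest_passage_time_le X_pos X_indep X_law mu_def.
split=> [p0 _ _|_]; first by exists D.
have VWx n x : (1 < n)%N -> xbar_equation nu mu n x ->
    ('V_P[W n] <= (D * x * n%:R ^+ 2)%:E)%E.
  move=> n1 ex; apply: le_trans (VW n (ltnW n1)) _; rewrite lee_fin.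
  rewrite -!mulrA ler_pM2l// expr2 mulrA mulrC ler_wpM2r//.
  by rewrite -ler_pdivrMr ?ltr0n ?(ltnW n1)//; exact: xbar_equation_ge ex.
exists D => //; split=> [n x n1 ex|alpha alpha0 [e /= e0 He]].
  by split; [exact: xbar_equation_unique|exact: VWx].
pose beta := (alpha + 1)^-1; have beta0 : 0 < beta by rewrite invr_gt0 addr_gt0.
(* [e] is the radius of the left neighbourhood of [mu] on which the power law holds. Below this
   threshold for [ln n / n], the explicit [x] satisfies [x < 2 e], so that [mu - x / 2] lies in that
   neighbourhood. *)
have c0 : 0 < (2 * e) `^ (alpha + 1) / 2 `^ alpha.
  by rewrite divr_gt0 ?powR_gt0// mulr_gt0.
near=> n.
have n1 : (1 < n)%N by near: n; exact: nbhs_infty_gt.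
have n0 : 0 < n%:R :> R by rewrite ltr0n ltnW.
have ln0 : 0 < ln n%:R :> R by rewrite ln_gt0 ?ltr1n.
pose x := (2 `^ alpha * (ln n%:R / n%:R)) `^ beta.
have x0 : 0 < x by rewrite powR_gt0// mulr_gt0 ?powR_gt0// divr_gt0.
have x_lt : x < 2 * e.
  have : ln n%:R / n%:R < (2 * e) `^ (alpha + 1) / 2 `^ alpha.
    by near: n; exact: near_ln_div_lt.
  rewrite ltr_pdivlMr ?powR_gt0// mulrC => lt_x.
  have -> : 2 * e = ((2 * e) `^ (alpha + 1)) `^ beta.
    by rewrite -powRrM mulfV ?gt_eqF ?addr_gt0// powRr1// mulr_ge0// ltW.
  by rewrite gt0_ltr_powR// nnegrE ?powR_ge0// mulr_ge0 ?powR_ge0// divr_ge0 ?ltW.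
have ex : xbar_equation nu mu n x.
  apply: (xbar_equation_powR alpha0 n1) => //.
  rewrite -/H He ?subKr//; last by rewrite ltrBlDr ltrDl divr_gt0.
  by rewrite /= subKr ger0_norm ?divr_ge0 ?ltW// ltr_pdivrMr// mulrC.
exists x; split; [exact: xbar_equation_unique|exact: VWx|].
(* For the explicit solution the last bound is an equality. *)
rewrite le_eqVlt; apply/orP; left; apply/eqP.
rewrite /x powRM ?powR_ge0 ?divr_ge0 ?ltW// powRM ?invr_ge0 ?ltW// -powRrM -/beta.
rewrite powRB; last by rewrite (gt_eqF n0) implybT.
rewrite powR_mulrn ?ltW//.
rewrite -powR_inv1 ?ltW// -powRrM mulN1r powRN.
ring.
Unshelve. all: by end_near. Qed.
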